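(* Let $X$ be a $p$-dimensional random vector and $Y$ a real random variable. Suppose that $Y$ and the elements of $X$ are square integrable and $E(X)=0$. Then: 1. $\mathcal{S}_{\mathrm{CSS}} \subseteq \mathcal{S}_{Y|X}$; 2. If, in addition, the linear conditional mean condition holds for both $\mathcal{S}_{\mathrm{CSS}}$ and $\mathcal{S}_{\mathrm{IR}}$, then $\mathcal{S}_{\mathrm{IR}} = \mathcal{S}_{\mathrm{CSS}}$.
   Context: $\Sigma=\mathrm{Var}(X)$ is assumed positive definite. $\mathrm{span}(\cdot)$ denotes column space. Central space: a subspace $\mathrm{span}(\beta)$ of $\mathbb{R}^p$ ($\beta$ a matrix with $p$ rows) is a dimension reduction space if $Y$ and $X$ are conditionally independent given $\beta^T X$. The intersection of all dimension reduction spaces is assumed to be itself a dimension reduction space; it is denoted $\mathcal{S}_{Y|X}$. Inverse regression space: $\mathcal{S}_{\mathrm{IR}}$ is the column space of the matrix $\Sigma^{-1}\mathrm{Var}[E(X|Y)]\Sigma^{-1}$. Central solution space: the inverse regression equation for a matrix $\beta$ with $p$ rows is $$E(X|Y)=E[E(X|\beta^T X)\,|\,Y]\quad\text{a.s.}$$ If $\beta$ satisfies it, $\mathrm{span}(\beta)$ is called a solution space of the equation. It is assumed that the intersection of any two solution spaces is again a solution space; the intersection of all solution spaces (which is then itself a solution space) is the central solution space $\mathcal{S}_{\mathrm{CSS}}$. Linear conditional mean condition: a subspace $\mathcal{S}\subseteq\mathbb{R}^p$ satisfies the condition if, for a matrix $\eta$ whose columns form a basis of $\mathcal{S}$, $E(X|\eta^T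 X)$ is a linear function of $X$, i.e. equals $AX$ a.s. for some nonrandom matrix $A$. (If $\mathcal{S}=\{0\}$, conditioning on $\eta^TX$ means conditioning on a constant.)
   Formalization: The linear conditional mean condition is taken as E(X|η^T X) = Bη^T X, linear in η^T X, instead of AX with arbitrary A; with arbitrary A part 2 fails for X = (x, x²−1), Y = x, x standard normal, where S_IR = R² but S_CSS is a line. *)

(* Defs.v *)
From HB Require Import structures.
From mathcomp Require Import all_boot all_order all_algebra.
From mathcomp Require Import all_classical all_reals all_analysis.
From mathcomp Require Import measurable_realfun.

Set Implicit Arguments.
Unset Strict Implicit.
Unset Printing Implicit Defensive.

Import Order.TTheory GRing.Theory Num.Theory.
Import numFieldNormedType.Exports.

Local Open Scope classical_set_scope.
Local Open Scope ring_scope.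

Section subspaces.
Context {R : realType} {p : nat}.
Implicit Types (V : {vspace 'cV[R]_p}) (F : set {vspace 'cV[R]_p}).

Definition columns (n : nat) (A : 'M[R]_(p, n)) : seq 'cV[R]_p :=
  [seq col j A | j : 'I_n].

Definition colspan (n : nat) (A : 'M[R]_(p, n)) : {vspace 'cV[R]_p} :=
  <<columns A>>%VS.

(* The intersection of an arbitrary family of subspaces; vbigcapE shows that
   the default value 0%VS is never used. *)
Definition vbigcap F : {vspace 'cV[R]_p} :=
  xget 0%VS [set V | [set` V] = \bigcap_(U in F) [set` U]].

Lemma vbigcapE F : [set` vbigcap F] = \bigcap_(U in F) [set` U].
Proof.
rewrite /vbigcap; case: xgetP => [V _ //|nex]; exfalso.
pose D := [set n | exists2 V : {vspace 'cV[R]_p},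
  [set` V] `<=` \bigcap_(U in F) [set` U] & \dim V = n].
have D0 : exists n, `[< D n >].
  exists 0%N; apply/asboolP; exists 0%VS; last exact: dimv0.
  by move=> v /=; rewrite memv0 => /eqP -> U _ /=; rewrite mem0v.
have Dub n : `[< D n >] -> (n <= \dim {:'cV[R]_p})%N.
  by move=> /asboolP[V _ <-]; exact/dimvS/subvf.
have [_ /asboolP[V VF <-] Vmax] := ex_maxnP D0 Dub.
apply: (nex V) => /=; apply/seteqP; split => // v vF /=.
have VvF : [set` (V + <[v]>)%VS] `<=` \bigcap_(U in F) [set` U].
  move=> _ /= /memv_addP[u uV [_ /vlineP[k ->]] ->] U FU /=.
  by rewrite memvD ?memvZ//; [exact: (VF u uV U FU)|exact: (vF U FU)].
have dimVv : (\dim (V + <[v]>) <= \dim V)%N.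
  by apply: Vmax; apply/asboolP; exists (V + <[v]>)%VS.
have /eqP -> : V == (V + <[v]>)%VS by rewrite eqEdim addvSl dimVv.
apply: (subvP (addvSr V <[v]>%VS)); exact: memv_line.
Qed.

End subspaces.

Definition posdefmx (R : realType) (p : nat) (S : 'M[R]_p) :=
  forall v : 'cV[R]_p, v != 0 -> 0 < (v^T *m S *m v) 0 0.

Section conditioning.
Context {d : measure_display} {T : measurableType d} {R : realType}.
Variable P : probability T R.
Implicit Types (G F : set (set T)) (Y Z W : T -> R).

Definition is_cond_exp G Z W :=
  [/\ forall B : set R, measurable B -> G (W @^-1` B),
      P.-integrable setT (EFin \o W) &
      forall A, G A ->
        (\int[P]_(t in A) (W t)%:E = \int[P]_(t in A) (Z t)%:E)%E].

(* A chosen version of E(Z | G); for integrable Z one exists (cond_expP), so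
   that the default value is not used. *)
Definition cond_exp G Z : T -> R := xget (cst 0) [set W | is_cond_exp G Z W].

Definition cond_prob G (A : set T) : T -> R := cond_exp G \1_A.

Definition cond_indep G F1 F2 :=
  forall A B, F1 A -> F2 B ->
    {ae P, forall t, cond_prob G (A `&` B) t =
                     cond_prob G A t * cond_prob G B t}.

Definition coords (n : nat) (Z : T -> 'cV[R]_n) : 'I_n -> T -> R :=
  fun i t => Z t i 0.

Definition sigmaV (n : nat) (Z : T -> 'cV[R]_n) : set (set T) :=
  g_sigma_preimage (coords Z).

Definition sigmaR Y : set (set T) := g_sigma_algebra_preimage Y.

Definition cond_expV (n : nat) G (Z : T -> 'cV[R]_n) : T -> 'cV[R]_n :=
  fun t => \col_i cond_exp G (coords Z i) t.

Definition varmx (n : nat) (Z : T -> 'cV[R]_n) : 'M[R]_n :=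
  \matrix_(i, j) fine (covariance P (coords Z i) (coords Z j)).

End conditioning.

Section cond_exp_existence.
Context {d : measure_display} {T : measurableType d} {R : realType}.
Variable P : probability T R.
Local Open Scope ereal_scope.
Local Open Scope charge_scope.

Lemma radon_nikodym_pushforward d' (T' : measurableType d')
    (i : {mfun T >-> T'}) (Z : T -> R) :
  P.-integrable setT (EFin \o Z) ->
  exists W : T' -> R, [/\ measurable_fun setT W,
    P.-integrable setT (EFin \o (W \o i)) &
    forall A, measurable A ->
     \int[P]_(t in i @^-1` A) (W (i t))%:E = \int[P]_(t in i @^-1` A) (Z t)%:E].
Proof.
move=> intZ.
have mi : measurable_fun setT i by [].
pose mu : probability T' R := distribution P i.
pose nu : {charge set T' -> \bar R} :=
  measure_function_pushforward__canonical__charge_Charge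
    (induced_charge intZ) mi.
have numu : nu `<< mu.
  apply: dominates_pushforward => //; apply/null_content_dominatesP => A mA PA0.
  change (\int[P]_(t in A) (Z t)%:E = 0); rewrite null_set_integral//.
  by apply: measurable_funTS; exact: measurable_int intZ.
pose f := 'd nu '/d mu.
have f_fin x : f x \is a fin_num by exact: Radon_Nikodym_fin_num.
have intf : mu.-integrable setT f by exact: Radon_Nikodym_integrable.
have fE : EFin \o (fine \o f) = f by apply/funext => x /=; rewrite fineK.
have mf : measurable_fun setT f by exact: measurable_int intf.
have intfi : P.-integrable setT (f \o i).
  apply/integrableP; split; first exact: measurableT_comp.
  move/integrableP : intf => [_].
  rewrite ge0_integral_pushforward//; last exact: measurableT_comp.
exists (fine \o f); split.
- by apply/measurable_EFinP; rewrite fE.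
- by rewrite -fE in intfi.
- move=> A mA; have -> : \int[P]_(t in i @^-1` A) (Z t)%:E = nu A by [].
  rewrite (Radon_Nikodym_integral numu mA) integral_pushforward//.
    by apply: eq_integral => t _; rewrite /= fineK.
  apply: (integrableS measurableT) => //.
  by rewrite -[X in measurable X]setTI; apply: (mi).
Qed.

Lemma cond_expP (G : set (set T)) (Z : T -> R) :
  sigma_algebra setT G -> G `<=` measurable ->
  P.-integrable setT (EFin \o Z) -> is_cond_exp P G Z (cond_exp P G Z).
Proof.
move=> sG GM intZ.
suff [W WP] : exists W, is_cond_exp P G Z W 
  by apply: (@xgetPex _ _ [set W | is_cond_exp P G Z W]); exists W.
have GE : (@measurable _ (g_sigma_algebraType G)) = G.
  exact: measurable_g_measurableTypeE.
pose i : T -> g_sigma_algebraType G := idfun.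
have mi : measurable_fun [set: T] i.
  by move=> _ B mB; rewrite setTI; apply: GM; rewrite -GE.
have [W [mW iW WE]] := radon_nikodym_pushforward
  (MeasurableFun.Pack (MeasurableFun.Class (isMeasurableFun.Build _ _ _ _ _ mi)))
  intZ.
exists W; split=> //.
- by move=> B mB; rewrite -GE -[X in measurable X]setTI; exact: mW.
- by move=> A GA; apply: WE; rewrite GE.
Qed.
End cond_exp_existence.

Section dimension_reduction.
Context {d : measure_display} {T : measurableType d} {R : realType}.
Variables (P : probability T R) (p : nat) (X : T -> 'cV[R]_p) (Y : T -> R).
Implicit Types V : {vspace 'cV[R]_p}.

Definition reduction (n : nat) (beta : 'M[R]_(p, n)) : T -> 'cV[R]_n :=
  fun t => beta^T *m X t.

Definition dr_space V :=
  exists n (beta : 'M[R]_(p, n)), V = colspan beta /\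
    cond_indep P (sigmaV (reduction beta)) (sigmaR Y) (sigmaV X).

Definition central_space : {vspace 'cV[R]_p} := vbigcap [set V | dr_space V].

Definition inverse_regression_space : {vspace 'cV[R]_p} :=
  colspan (invmx (varmx P X) *m varmx P (cond_expV P (sigmaR Y) X)
           *m invmx (varmx P X)).

Definition inverse_regression_eq (n : nat) (beta : 'M[R]_(p, n)) :=
  {ae P, forall t, cond_expV P (sigmaR Y) X t =
    cond_expV P (sigmaR Y) (cond_expV P (sigmaV (reduction beta)) X) t}.

Definition solution_space V :=
  exists n (beta : 'M[R]_(p, n)),
    V = colspan beta /\ inverse_regression_eq beta.

Definition central_solution_space : {vspace 'cV[R]_p} :=
  vbigcap [set V | solution_space V].

(* E(X | eta^T X) = A X with A = B eta^T, i.e. linear in the conditioning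
   vector. An arbitrary A would be too weak: for X = (x, x^2 - 1) with x standard
   normal, E(X | x) = X would count as linear, and with Y = x the inverse
   regression space is R^2 while the central solution space is a line. *)
Definition linear_cond_mean V :=
  exists n (eta : 'M[R]_(p, n)), basis_of V (columns eta) /\
    exists B : 'M[R]_(p, n), {ae P, forall t,
      cond_expV P (sigmaV (reduction eta)) X t = (B *m eta^T) *m X t}.

End dimension_reduction.

(* Main.v *)
Require Import Defs.
From HB Require Import structures.
From mathcomp Require Import all_boot all_order all_algebra.
From mathcomp Require Import all_classical all_reals all_analysis.
From mathcomp Require Import measurable_realfun.
From mathcomp Require Import lra.

Set Implicit Arguments.
Unset Strict Implicit.
Unset Printing Implicit Defensive.

Import Order.TTheory GRing.Theory Num.Theory.
Import numFieldNormedType.Exports.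
Local Open Scope classical_set_scope.
Local Open Scope ring_scope.

(** Write Sigma = E(X X^T), m = E(X | Y), M = Var(m) = E(m m^T).

Conditional expectations are only known through their integrals, so everything
rests on the pull-out property E(f W) = E(f Z) for W = E(Z | G) and f measurable
with respect to G (integral_mul_orth, cond_exp_pull_out). It yields almost sure
uniqueness, stability of square integrability, and hence a calculus of the
matrices E(U V^T) in which E(X | G) can be replaced by X against any
G-measurable V (cross_moment_cond_expV).

The central space contains the central solution space. Suppose Y and X are
independent given G = sigma(beta^T X), and let A be a Y-event. Then P(A | G) is
also P(A | X), so that E(1_A X) = E(P(A | G) X) = E(P(A | G) E(X | G))
= E(1_A E(X | G)), which says that X and E(X | G) have the same conditional
expectation given Y (cond_indep_tower). So every dimension reduction space is a
solution space, and the central solution space is the smallest of those. It is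
moreover a solution space itself: a solution space of least dimension is
contained in all the others, since the family is closed under intersection
(vbigcap_mem).

Under linearity the two spaces coincide. If E(X | eta^T X) = A X with
A = B eta^T, then A is the Sigma-orthogonal projection onto Sigma span(eta):
A Sigma eta = Sigma eta, and A Sigma = Sigma eta B^T is symmetric
(linear_cond_mean_projection). Moreover span(eta) is a solution space exactly
when m = A m almost surely.
- When span(eta) is a solution space, M = A M, and therefore the columns of
  Sigma^-1 M Sigma^-1 = eta B^T Sigma^-1 M Sigma^-1 lie in span(eta). With
  span(eta) the central solution space, this is one inclusion.
- When span(eta) is the inverse regression space, the columns of M lie in
  Sigma span(eta), on which A is the identity. So (I - A) M = 0, the second
  moment of (I - A) m vanishes, m = A m, and span(eta) is a solution space: the
  other inclusion. *)

(** * Functions measurable with respect to a sub-sigma-algebra *)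

Section sub_sigma_algebra.
Context {d : measure_display} {T : measurableType d} {R : realType}.
Variable G : set (set T).
Hypothesis sG : sigma_algebra setT G.

Definition measurable_wrt (f : T -> R) :=
  forall B, measurable B -> G (f @^-1` B).

(** Identifies the elementary form of measurability used in [is_cond_exp] with
measurability on the type carrying G as its measurable sets, where sums,
products, truncations and simple approximations are available. *)
Lemma measurable_wrtP (f : T -> R) :
  measurable_wrt f <-> measurable_fun [set: g_sigma_algebraType G] f.
Proof.
have GE := measurable_g_measurableTypeE sG.
split=> [mf _ B mB|mf B mB]; first by rewrite setTI GE; exact: mf.
by rewrite -GE -[X in measurable X]setTI; apply: mf.
Qed.

Lemma measurable_wrt_fun (f : T -> R) :
  G `<=` measurable -> measurable_wrt f -> measurable_fun setT f.
Proof. by move=> GM mf _ B mB; rewrite setTI; apply: GM; exact: mf. Qed.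

End sub_sigma_algebra.

(** * The pull-out property *)

Section pull_out.
Context {d : measure_display} {T : measurableType d} {R : realType}.
Variables (P : probability T R) (G : set (set T)).
Hypotheses (sG : sigma_algebra setT G) (GM : G `<=` measurable).

Section orthogonal.
Variable h : T -> R.
Hypotheses (intp : P.-integrable setT (EFin \o h)).
Hypotheses (h0 : forall A, G A -> (\int[P]_(t in A) (h t)%:E = 0)%E).

Import HBSimple HBNNSimple.

Let orth_nnsfun (s : {nnsfun g_sigma_algebraType G >-> R}) :
  (\int[P]_t (s t * h t)%:E = 0)%E.
Proof.
under eq_integral => t _.
  rewrite (fimfunEord s t) mulr_suml -sumEFin.
  under eq_bigr => i _ do rewrite -mulrA EFinM.
  over.
have GA (r : R) : G (s @^-1` [set r]).
  have /(measurable_wrtP sG) ms : measurable_fun setT (s : _ -> R) by [].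
  exact: ms (measurable_set1 r).
have int1 (r : R) :
   P.-integrable setT (fun t => ((\1_(s @^-1` [set r]) t : R) * h t)%:E).
  apply: le_integrable intp => //.
    apply/measurable_EFinP; apply: measurable_funM.
      by apply: measurable_indic; apply: GM; exact: GA.
    by apply/measurable_EFinP; exact: measurable_int intp.
  move=> t _ /=; rewrite lee_fin normrM indicE.
  by case: (_ \in _); rewrite ?normr1 ?mul1r// normr0 mul0r.
rewrite integral_sum//=; last first.
  by move=> i; apply: integrableZl.
apply: big1 => i _; rewrite integralZl//=.
set A := (_ @^-1` _); rewrite [X in (_ * X)%E](_ : _ = 0%E) ?mule0//.
rewrite -[RHS](@h0 A); last exact: GA.
rewrite [RHS]integral_mkcond; apply: eq_integral => t _.
by rewrite patchE indicE; case: ifPn => _; rewrite ?mul1r ?mul0r.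
Qed.

(* Approximation of f from below by simple functions s n measurable with
   respect to G; all the s n * h are dominated by |f * h|. *)
Let orth_ge0 (f : T -> R) : measurable_wrt G f -> (forall t, 0 <= f t) ->
  P.-integrable setT (EFin \o (f \* h)) -> (\int[P]_t (f t * h t)%:E = 0)%E.
Proof.
move=> mf f0 ifh.
have mfG : measurable_fun [set: g_sigma_algebraType G] (EFin \o f).
  by apply/measurable_EFinP; exact/(measurable_wrtP sG).
have f0' (t : g_sigma_algebraType G) : setT t -> (0 <= (EFin \o f) t)%E.
  by rewrite lee_fin.
pose s := nnsfun_approx measurableT mfG.
have mh : measurable_fun setT h.
  by apply/measurable_EFinP; exact: measurable_int intp.
have ms n : measurable_fun [set: T] (s n : T -> R).
  by apply: (measurable_wrt_fun GM); apply/(measurable_wrtP sG).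
have [] := @dominated_convergence _ _ _ P setT measurableT
  (fun n t => (s n t * h t)%:E) (fun t => (f t * h t)%:E)
  (fun t => `|f t * h t|%:E).
- by move=> n; apply/measurable_EFinP; exact: measurable_funM.
- exact: measurable_int ifh.
- apply: aeW => t _.
  under eq_fun do rewrite EFinM.
  rewrite EFinM; apply: cvgeZr => //.
  exact: (cvg_nnsfun_approx measurableT mfG f0').
- exact: integrable_norm ifh.
- apply: aeW => t n _; rewrite lee_fin !normrM ler_wpM2r//.
  rewrite !ger0_norm// -lee_fin /s nnsfun_approxE.
  exact: (le_approx _ f0').
move=> _ _ + ; rewrite (_ : (fun _ => _) = cst 0%E).
  by move=> /cvg_lim <-//; rewrite lim_cst.
by apply/funext => n; exact: orth_nnsfun.
Qed.

(** Since h integrates to 0 on all of G, it is orthogonal to the indicators of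
G, hence to simple functions, and dominated convergence gives the rest. Only the
integrability of the product f h is asked, which covers both bounded f and
square integrable f and h. *)
Lemma integral_mul_orth (f : T -> R) : measurable_wrt G f ->
  P.-integrable setT (EFin \o (f \* h)) -> (\int[P]_t (f t * h t)%:E = 0)%E.
Proof.
move=> /(measurable_wrtP sG) mf ifh.
have intsub (g : T -> R) : measurable_wrt G g -> (forall t, `|g t| <= `|f t|) ->
    P.-integrable setT (EFin \o (g \* h)).
  move=> mg gf; apply: le_integrable ifh => //.
    apply/measurable_EFinP; apply: measurable_funM.
      exact: measurable_wrt_fun mg.
    by apply/measurable_EFinP; exact: measurable_int intp.
  by move=> t _ /=; rewrite lee_fin !normrM ler_wpM2r.
have mp : measurable_wrt G (f^\+)%R.
  by apply/(measurable_wrtP sG); exact: measurable_funrpos.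
have mn : measurable_wrt G (f^\-)%R.
  by apply/(measurable_wrtP sG); exact: measurable_funrneg.
have ip : P.-integrable setT (EFin \o (f^\+ \* h)%R).
  apply: intsub => // t; rewrite ger0_norm ?funrpos_ge0// /funrpos.
  by rewrite ge_max ler_norm normr_ge0.
have iN : P.-integrable setT (EFin \o (f^\- \* h)%R).
  apply: intsub => // t; rewrite ger0_norm ?funrneg_ge0// /funrneg.
  by rewrite ge_max -normrN ler_norm normr_ge0.
transitivity (\int[P]_t (((f^\+ \* h) t)%:E - ((f^\- \* h) t)%:E))%E.
  apply: eq_integral => t _; rewrite -EFinB /= -mulrBl.
  by rewrite -[in LHS](funrposBneg f).
by rewrite integralB//= !orth_ge0 ?sube0.
Qed.

End orthogonal.
End pull_out.

(** * Square integrable functions *)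

Section square_integrable.
Context {d : measure_display} {T : measurableType d} {R : realType}.
Variable P : probability T R.

Lemma Lfun2P (f : T -> R) : f \in Lfun P 2%:E <->
  measurable_fun setT f /\ P.-integrable setT (EFin \o (fun t => f t ^+ 2)).
Proof.
split=> [l2|[mf /integrableP[_ fi]]].
  split; last exact: Lfun2_integrable_sqr.
  by move: l2; rewrite inE => /andP[/[!inE]].
rewrite inE; apply/andP; split; rewrite inE//=.
rewrite /finite_norm unlock /Lnorm poweR_lty//.
apply: le_lt_trans fi; rewrite le_eqVlt; apply/orP; left; apply/eqP.
by apply: eq_integral => t _ /=; rewrite normrX powR_mulrn.
Qed.

Lemma Lfun2_measurable (f : T -> R) :
  f \in Lfun P 2%:E -> measurable_fun setT f.
Proof. by move=> /Lfun2P[]. Qed.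

Lemma Lfun2_integrableM (f g : T -> R) :
  f \in Lfun P 2%:E -> g \in Lfun P 2%:E ->
  P.-integrable setT (EFin \o (f \* g)).
Proof. by move=> f2 g2; apply/Lfun1_integrable; exact: Lfun2_mul_Lfun1. Qed.

Lemma Lfun2_integrable (f : T -> R) :
  f \in Lfun P 2%:E -> P.-integrable setT (EFin \o f).
Proof.
move=> f2; apply/Lfun1_integrable.
by apply: Lfun_subset12; rewrite ?fin_num_measure.
Qed.

Lemma Lfun2_sum (I : Type) (s : seq I) (a : I -> R) (f : I -> T -> R) :
  (forall i, f i \in Lfun P 2%:E) ->
  (fun t => \sum_(i <- s) a i * f i t) \in Lfun P 2%:E.
Proof.
move=> f2.
elim: s => [|i s ih].
  by under eq_fun do rewrite big_nil; exact: Lfun_cst.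
under eq_fun do rewrite big_cons.
rewrite (_ : (fun _ => _) =
   (a i \o* f i) \+ (fun t => \sum_(j <- s) a j * f j t)); last first.
  by apply/funext => t /=; rewrite mulrC.
apply: (rpredD (V := T -> R)) => [|H|H]; [by rewrite lee1n| |exact: ih].
by apply: Lfun_scale => //; rewrite ler1n.
Qed.

Lemma Lfun2_bounded (f : T -> R) (M : R) : measurable_fun setT f ->
  (forall t, `|f t| <= M) -> f \in Lfun P 2%:E.
Proof.
move=> mf fM; apply/Lfun2P; split => //.
apply: (le_integrable measurableT _ _
  (finite_measure_integrable_cst P (M ^+ 2) measurableT)).
  by apply/measurable_EFinP; exact: measurable_funX.
move=> t _ /=; rewrite lee_fin !normrX lerXn2r ?nnegrE//.
by rewrite (le_trans (fM t))// ler_norm.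
Qed.

Lemma Lfun2_indic (A : set T) : measurable A -> (\1_A : T -> R) \in Lfun P 2%:E.
Proof.
move=> mA; apply: (Lfun2_bounded (M := 1)); first exact: measurable_indic.
by move=> t; rewrite indicE; case: (_ \in _); rewrite ?normr1// normr0.
Qed.

End square_integrable.

(** * Conditional expectations given a sub-sigma-algebra *)

Section cond_exp_theory.
Context {d : measure_display} {T : measurableType d} {R : realType}.
Variables (P : probability T R) (G : set (set T)).
Hypotheses (sG : sigma_algebra setT G) (GM : G `<=` measurable).
Implicit Types Z W f : T -> R.

Lemma cond_exp_measurable Z W : is_cond_exp P G Z W -> measurable_fun setT W.
Proof. by case=> mW _ _; exact: measurable_wrt_fun mW. Qed.

Lemma cond_exp_orth Z W A : P.-integrable setT (EFin \o Z) ->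
  is_cond_exp P G Z W -> G A -> (\int[P]_(t in A) ((W \- Z) t)%:E = 0)%E.
Proof.
move=> iZ [_ iW WE] GA; under eq_integral do rewrite /= EFinB.
have mA := GM GA.
have iZA : P.-integrable A (EFin \o Z) by apply: integrableS iZ.
have iWA : P.-integrable A (EFin \o W) by apply: integrableS iW.
rewrite integralB//= WE// subee//.
exact: integrable_fin_num iZA.
Qed.

Lemma cond_exp_pull_out Z W f : measurable_wrt G f -> is_cond_exp P G Z W ->
  P.-integrable setT (EFin \o Z) ->
  P.-integrable setT (EFin \o (f \* Z)) ->
  P.-integrable setT (EFin \o (f \* W)) ->
  (\int[P]_t (f t * W t)%:E = \int[P]_t (f t * Z t)%:E)%E.
Proof.
move=> mf ce iZ ifZ ifW; have [_ iW _] := ce.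
have ifWZ : P.-integrable setT (EFin \o (f \* (W \- Z))).
  apply: eq_integrable (integrableB measurableT ifW ifZ) => //.
  by move=> t _ /=; rewrite mulrBr EFinB.
have : (\int[P]_t (f t * (W \- Z) t)%:E = 0)%E.
  apply: (integral_mul_orth sG) => //.
    apply: eq_integrable (integrableB measurableT iW iZ) => //.
  by move=> A; exact: cond_exp_orth.
under eq_integral do rewrite /= mulrBr EFinB.
rewrite integralB// => /eqP; rewrite sube_eq//.
- by rewrite add0e => /eqP.
- exact: integrable_fin_num ifW.
Qed.

(** W - W' integrates to 0 on all of G and is itself measurable with respect to
G, so that it is orthogonal to its own sign. Allowing Z and Z' to differ, as long
as they have the same integrals on G, is what makes the lemma prove tower
identities. *)
Lemma cond_exp_unique Z Z' W W' :
  is_cond_exp P G Z W -> is_cond_exp P G Z' W' ->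
  (forall A, G A ->
     \int[P]_(t in A) (Z t)%:E = \int[P]_(t in A) (Z' t)%:E)%E ->
  {ae P, forall t, W t = W' t}.
Proof.
move=> [mW iW WE] [mW' iW' WE'] ZZ'.
have ceWW' : is_cond_exp P G W' W.
  by split => // A GA; rewrite WE// ZZ'// WE'.
(* f is the sign of h, with value 1 where h vanishes. *)
pose h := W \- W'; pose f t := if 0 <= h t then 1 else - 1 : R.
have mf : measurable_wrt G f.
  apply/(measurable_wrtP sG); apply: measurable_fun_ifT => //.
  apply: measurable_fun_ler => //.
  by apply: measurable_funB; exact/(measurable_wrtP sG).
have fh t : f t * h t = `|h t|.
  rewrite /f; case: ifPn => [h0|]; first by rewrite mul1r ger0_norm.
  by rewrite -ltNge => h0; rewrite mulN1r ltr0_norm.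
have ih : P.-integrable setT (EFin \o h).
  by apply: eq_integrable (integrableB measurableT iW iW').
have : (\int[P]_t (f t * h t)%:E = 0)%E.
  apply: (integral_mul_orth sG) => //.
    by move=> A; exact: cond_exp_orth.
  apply: eq_integrable (integrable_norm ih) => //.
  by move=> t _ /=; rewrite fh.
under eq_integral do rewrite fh -abse_EFin.
have mhT := measurable_int _ ih.
move=> /(ae_eq_integral_abs P measurableT mhT).
by apply: filterS => t /(_ I)[] /eqP; rewrite subr_eq0 => /eqP.
Qed.

Lemma cond_exp_sum n (a : 'I_n -> R) (Z W : 'I_n -> T -> R) :
  (forall i, P.-integrable setT (EFin \o Z i)) ->
  (forall i, is_cond_exp P G (Z i) (W i)) ->
  is_cond_exp P G (fun t => \sum_i a i * Z i t) (fun t => \sum_i a i * W i t).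
Proof.
move=> iZ ce; split.
- apply/(measurable_wrtP sG); apply: measurable_sum => i.
  apply: measurable_funM => //; apply/(measurable_wrtP sG).
  by have [] := ce i.
- rewrite (_ : _ \o _ = fun t => (\sum_i (a i)%:E * (W i t)%:E)%E).
    apply: integrable_sum => // i _; apply: integrableZl => //.
    by have [] := ce i.
  by apply/funext => t /=; rewrite -sumEFin.
- move=> A GA; have mA := GM GA.
  under eq_integral do rewrite -sumEFin.
  under [RHS]eq_integral do rewrite -sumEFin.
  have iZA i : P.-integrable A (EFin \o Z i) by apply: integrableS (iZ i).
  have iWA i : P.-integrable A (EFin \o W i).
    by have [_ iW _] := ce i; apply: integrableS iW.
  rewrite !integral_sum//; last 2 first.
  + by move=> i; under eq_fun do rewrite EFinM; exact: integrableZl (iZA i).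
  + by move=> i; under eq_fun do rewrite EFinM; exact: integrableZl (iWA i).
  apply: eq_bigr => i _.
  under eq_integral do rewrite EFinM.
  under [RHS]eq_integral do rewrite EFinM.
  rewrite !integralZl//; [|exact: iZA|exact: iWA].
  by have [_ _ ->] := ce i.
Qed.

(** For the truncations f n of W, E(f_n^2) = E(f_n W) = E(f_n Z), which is at most
(E(f_n^2) + E(Z^2)) / 2. Hence E(f_n^2) <= E(Z^2), and Fatou's lemma gives
E(W^2) <= E(Z^2). Truncating first makes the pull-out property applicable before
W is known to be square integrable. *)
Lemma cond_exp_Lfun2 Z W : Z \in Lfun P 2%:E -> is_cond_exp P G Z W ->
  W \in Lfun P 2%:E.
Proof.
move=> Z2 ce; have [mW iW _] := ce.
have mWT := cond_exp_measurable ce.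
pose f (n : nat) t : R := if `|W t| <= n%:R then W t else 0.
have mf n : measurable_wrt G (f n).
  apply/(measurable_wrtP sG).
  have mWG := (measurable_wrtP sG _).1 mW.
  apply: measurable_fun_ifT => //.
  by apply: measurable_fun_ler => //; exact: measurableT_comp.
have fn n t : `|f n t| <= n%:R.
  by rewrite /f; case: ifPn => //; rewrite normr0.
have f2 n : f n \in Lfun P 2%:E.
  apply: (Lfun2_bounded P (M := n%:R)) => //.
  exact: measurable_wrt_fun (mf n).
have fW n t : f n t * W t = f n t ^+ 2.
  by rewrite /f; case: ifPn => _; rewrite ?mul0r ?expr0n.
have le n : (\int[P]_t (f n t ^+ 2)%:E <= \int[P]_t (Z t ^+ 2)%:E)%E.
  have ifn := Lfun2_integrable_sqr (f2 n).
  have iZ := Lfun2_integrable_sqr Z2.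
  have ifZ := Lfun2_integrableM (f2 n) Z2.
  have E : (\int[P]_t (f n t ^+ 2)%:E = \int[P]_t (f n t * Z t)%:E)%E.
    transitivity (\int[P]_t (f n t * W t)%:E)%E.
      by apply: eq_integral => t _; rewrite fW.
    apply: cond_exp_pull_out => //.
      exact: Lfun2_integrable.
    by apply: eq_integrable ifn => // t _ /=; rewrite fW.
  have : (\int[P]_t ((f n t * Z t) + (f n t * Z t))%:E <=
     \int[P]_t (f n t ^+ 2 + Z t ^+ 2)%:E)%E.
    apply: le_integral => //.
    - by under eq_fun do rewrite EFinD; exact: integrableD.
    - by under eq_fun do rewrite EFinD; exact: integrableD.
    - move=> t _; rewrite lee_fin -subr_ge0.
      have := sqr_ge0 (f n t - Z t); rewrite sqrrB; lra.
  under eq_integral do rewrite EFinD.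
  under [leRHS]eq_integral do rewrite EFinD.
  rewrite !integralD// -E leeD2lE//; exact: integrable_fin_num ifn.
apply/Lfun2P; split => //; apply/integrableP; split.
  by apply/measurable_EFinP; exact: measurable_funX.
apply: (@le_lt_trans _ _ (\int[P]_t (Z t ^+ 2)%:E)%E); last first.
  have iZ := Lfun2_integrable_sqr Z2.
  exact: integrable_lty iZ.
have mfT n : measurable_fun setT (fun t => (f n t ^+ 2)%:E).
  apply/measurable_EFinP; apply: measurable_funX.
  exact: measurable_wrt_fun (mf n).
have := fatou P measurableT mfT.
(* At each t the sequence f n t is eventually constant, equal to W t. *)
have -> : (fun t => limn_einf (fun n => (f n t ^+ 2)%:E)) =
    (fun t => `|(W t ^+ 2)%:E|)%E.
  apply/funext => t.
  have cv : (f n t ^+ 2)%:E @[n --> \oo] --> (W t ^+ 2)%:E.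
    apply/cvg_EFin => //; first by near=> n.
    apply: (cvg_near_cst (W t ^+ 2 : R)); near=> n.
    rewrite /f /= ifT//; near: n; exact: nbhs_infty_ger.
  rewrite is_cvg_limn_einfE; last by apply/cvg_ex; eexists; exact: cv.
  by rewrite (cvg_lim _ cv)// gee0_abs// lee_fin sqr_ge0.
move=> /(_ _)/le_trans; apply.
  by move=> n t _; rewrite lee_fin sqr_ge0.
rewrite limn_einf_lim; apply: lime_le; first exact: is_cvg_einfs.
apply: nearW => n; apply: le_trans (le n).
by apply: ereal_inf_lbound; exists n => //=.
Unshelve. all: by end_near.
Qed.

End cond_exp_theory.

(** * Column spaces and intersections of subspaces *)

Section column_space.
Context {R : realType} {p : nat}.

Lemma col_columns n (A : 'M[R]_(p, n)) j : col j A \in columns A.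
Proof. by apply/mapP; exists j; rewrite ?mem_enum. Qed.

Lemma colspanP n (A : 'M[R]_(p, n)) v :
  reflect (exists c : 'cV[R]_n, v = A *m c) (v \in colspan A).
Proof.
have colE (c : 'cV[R]_n) : A *m c = \sum_j c j 0 *: col j A.
  apply/colP => i; rewrite !mxE summxE; apply: eq_bigr => j _.
  by rewrite !mxE mulrC.
apply: (iffP idP) => [vA|[c ->]]; last first.
  rewrite colE; apply: memv_suml => j _; apply: memvZ; apply: memv_span.
  exact: col_columns.
rewrite /colspan span_def in vA.
have [u uA ->] : exists2 u : 'I_n -> R, True & v = \sum_j u j *: col j A.
  move: vA; rewrite /columns big_image/= => /memv_sumP[w wA ->].
  have /fin_all_exists[u uE] j : exists k, w j = k *: col j A.
    by have /vlineP := wA j isT.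
  by exists u => //; apply: eq_bigr => j _; exact: uE.
exists (\col_j u j); rewrite colE.
by apply: eq_bigr => j _; rewrite mxE.
Qed.

Lemma colspan_mulmx m n (A : 'M[R]_(p, m)) (B : 'M[R]_(m, n)) :
  (colspan (A *m B) <= colspan A)%VS.
Proof.
apply/subvP => _ /colspanP[c ->]; apply/colspanP.
by exists (B *m c); rewrite mulmxA.
Qed.

Lemma colspan_factor m n (A : 'M[R]_(p, m)) (B : 'M[R]_(p, n)) :
  (colspan B <= colspan A)%VS -> exists C, B = A *m C.
Proof.
move=> /subvP BA.
have /fin_all_exists[c cE] j : exists c, col j B = A *m c.
  by apply/colspanP; apply: BA; apply: memv_span; exact: col_columns.
exists (\matrix_(i, j) c j i 0); apply/matrixP => i j.
have /colP/(_ i) := cE j; rewrite !mxE => ->.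
by apply: eq_bigr => k _; rewrite mxE.
Qed.

Lemma vbigcap_sub (F : set {vspace 'cV[R]_p}) V : F V -> (vbigcap F <= V)%VS.
Proof.
move=> FV; apply/subvP => v vF.
by have : [set` vbigcap F] v by []; rewrite vbigcapE; apply.
Qed.

(** A member of F of least dimension is contained in every other member U,
because its intersection with U is again in F and cannot be smaller. So closure
under pairwise intersections is enough even for an infinite family. *)
Lemma vbigcap_mem (F : set {vspace 'cV[R]_p}) V0 : F V0 ->
  (forall U V, F U -> F V -> F (U :&: V)%VS) -> F (vbigcap F).
Proof.
move=> FV0 FI; pose D n := `[< exists2 V, F V & \dim V = n >].
have D0 : exists n, D n by exists (\dim V0); apply/asboolP; exists V0.
have [_ /asboolP[V FV <-] Vmin] := ex_minnP D0.
suff -> : vbigcap F = V by [].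
apply: subv_anti; rewrite vbigcap_sub//=; apply/subvP => v vV.
suff : [set` vbigcap F] v by [].
rewrite vbigcapE => U FU /=.
have : (V :&: U == V)%VS.
  rewrite eqEdim capvSl Vmin//; apply/asboolP; exists (V :&: U)%VS => //.
  exact: FI.
by move=> /eqP VU; move: vV; rewrite -VU memv_cap => /andP[].
Qed.

Lemma posdefmx_unit (S : 'M[R]_p) : posdefmx S -> S \in unitmx.
Proof.
move=> Spos; rewrite unitmxE unitfE; apply/det0P => -[v v0 vS].
have := Spos v^T; rewrite trmx_eq0 => /(_ v0).
by rewrite trmxK vS mul0mx mxE ltxx.
Qed.

End column_space.

(** * Sigma-algebras generated by random vectors *)

Section generated_sigma_algebras.
Context {d : measure_display} {T : measurableType d} {R : realType}.

Lemma sigma_algebra_sigmaR (Y : T -> R) : sigma_algebra setT (sigmaR Y).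
Proof. exact/sigma_algebra_preimage/sigma_algebra_measurable. Qed.

Lemma sigmaR_measurable (Y : T -> R) :
  measurable_fun setT Y -> sigmaR Y `<=` measurable.
Proof. by move=> mY _ [B mB <-]; exact: mY. Qed.

Section vector.
Context {n : nat}.
Variable Z : T -> 'cV[R]_n.

Lemma sigma_algebra_sigmaV : sigma_algebra setT (sigmaV Z).
Proof. exact: smallest_sigma_algebra. Qed.

Lemma sigmaV_coords i : measurable_wrt (sigmaV Z) (coords Z i).
Proof.
move=> B mB; apply: sub_sigma_algebra; rewrite (bigD1 i)//=; left.
by exists B => //; rewrite setTI.
Qed.

Lemma sigmaV_sub (G : set (set T)) : sigma_algebra setT G ->
  (forall i, measurable_wrt G (coords Z i)) -> sigmaV Z `<=` G.
Proof.
move=> sG mZ; apply: smallest_sub => //.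
elim/big_ind: _ => // [A B AG BG C [/AG|/BG]//|i _ _ [B mB <-]].
by rewrite setTI; exact: mZ.
Qed.

End vector.

Lemma measurable_wrt_mulmx (G : set (set T)) m n (A : 'M[R]_(m, n))
    (Z : T -> 'cV[R]_n) : sigma_algebra setT G ->
  (forall i, measurable_wrt G (coords Z i)) ->
  forall i, measurable_wrt G (coords (fun t => A *m Z t) i).
Proof.
move=> sG mZ i; apply/(measurable_wrtP sG).
rewrite (_ : coords _ i = fun t => \sum_j A i j * coords Z j t); last first.
  by apply/funext => t; rewrite /coords mxE.
apply: measurable_sum => j; apply: measurable_funM => //.
exact/(measurable_wrtP sG).
Qed.

Lemma sigmaV_mulmx m n (A : 'M[R]_(m, n)) (Z : T -> 'cV[R]_n) :
  sigmaV (fun t => A *m Z t) `<=` sigmaV Z.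
Proof.
have sZ := sigma_algebra_sigmaV Z.
apply: sigmaV_sub => //; apply: measurable_wrt_mulmx => //.
exact: sigmaV_coords.
Qed.

(** If beta = eta C then beta^T X = C^T (eta^T X) is a function of eta^T X. In
particular the sigma-algebra of a reduction depends on its matrix only through
the column space. *)
Lemma sigmaV_reduction_sub p m n (X : T -> 'cV[R]_p) (beta : 'M[R]_(p, m))
    (eta : 'M[R]_(p, n)) : (colspan beta <= colspan eta)%VS ->
  sigmaV (reduction X beta) `<=` sigmaV (reduction X eta).
Proof.
move=> /colspan_factor[C ->].
rewrite (_ : reduction X (eta *m C) = fun t => C^T *m reduction X eta t).
  exact: sigmaV_mulmx.
by apply/funext => t; rewrite /reduction trmx_mul mulmxA.
Qed.

End generated_sigma_algebras.

(** * Second moments of random vectors *)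

Section cross_moment.
Context {d : measure_display} {T : measurableType d} {R : realType}.
Variable P : probability T R.

Definition sq_integrable n (U : T -> 'cV[R]_n) :=
  forall i, coords U i \in Lfun P 2%:E.

(** The matrix E(U V^T). Second moments rather than covariances are used since
all vectors involved are centred (see [varmxE]). *)
Definition cross_moment m n (U : T -> 'cV[R]_m) (V : T -> 'cV[R]_n) :
  'M[R]_(m, n) := \matrix_(i, j) \int[P]_t (coords U i t * coords V j t).

Lemma coords_mulmx m n (A : 'M[R]_(m, n)) (U : T -> 'cV[R]_n) i :
  coords (fun t => A *m U t) i = fun t => \sum_j A i j * coords U j t.
Proof. by apply/funext => t; rewrite /coords mxE. Qed.

Lemma sigmaV_measurable n (U : T -> 'cV[R]_n) :
  sq_integrable U -> sigmaV U `<=` measurable.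
Proof.
move=> U2; apply: sigmaV_sub => [|i B mB]; first exact: sigma_algebra_measurable.
by rewrite -[X in measurable X]setTI; exact: (Lfun2_measurable (U2 i)).
Qed.

Lemma sq_integrable_mulmx m n (A : 'M[R]_(m, n)) (U : T -> 'cV[R]_n) :
  sq_integrable U -> sq_integrable (fun t => A *m U t).
Proof. by move=> U2 i; rewrite coords_mulmx; exact: Lfun2_sum. Qed.

Lemma cross_momentT m n (U : T -> 'cV[R]_m) (V : T -> 'cV[R]_n) :
  (cross_moment U V)^T = cross_moment V U.
Proof.
apply/matrixP => i j; rewrite !mxE; apply: eq_Rintegral => t _.
by rewrite mulrC.
Qed.

Lemma cross_moment_mull k m n (A : 'M[R]_(k, m)) (U : T -> 'cV[R]_m)
    (V : T -> 'cV[R]_n) : sq_integrable U -> sq_integrable V ->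
  cross_moment (fun t => A *m U t) V = A *m cross_moment U V.
Proof.
move=> U2 V2; apply/matrixP => i j; rewrite !mxE.
have iUV l : P.-integrable setT (EFin \o (coords U l \* coords V j)).
  exact: Lfun2_integrableM.
rewrite /Rintegral coords_mulmx.
under eq_integral => t _.
  rewrite mulr_suml -sumEFin.
  under eq_bigr => l _ do rewrite -mulrA EFinM.
  over.
rewrite integral_sum//; last first.
  by move=> l; apply: integrableZl => //; exact: iUV.
rewrite (eq_bigr (fun l => (A i l)%:E *
    \int[P]_t (coords U l t * coords V j t)%:E)%E); last first.
  by move=> l _; apply: integralZl => //; exact: iUV.
have fin l : (\int[P]_t (coords U l t * coords V j t)%:E)%E \is a fin_num.
  exact: integrable_fin_num (iUV l).
rewrite -sum_fine; last by move=> l _; rewrite fin_numM.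
by apply: eq_bigr => l _; rewrite mxE fineM.
Qed.

Lemma cross_moment_mulr k m n (A : 'M[R]_(k, n)) (U : T -> 'cV[R]_m)
    (V : T -> 'cV[R]_n) : sq_integrable U -> sq_integrable V ->
  cross_moment U (fun t => A *m V t) = cross_moment U V *m A^T.
Proof.
move=> U2 V2; apply: trmx_inj.
by rewrite cross_momentT cross_moment_mull// trmx_mul trmxK cross_momentT.
Qed.

Lemma cross_moment_ae m n (U U' : T -> 'cV[R]_m) (V : T -> 'cV[R]_n) :
  sq_integrable U -> sq_integrable U' -> sq_integrable V ->
  {ae P, forall t, U t = U' t} ->
  cross_moment U V = cross_moment U' V.
Proof.
move=> U2 U2' V2 UU'; apply/matrixP => i j; rewrite !mxE /Rintegral.
congr fine; apply: ae_eq_integral => //.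
- apply/measurable_EFinP; apply: measurable_funM;
    exact: Lfun2_measurable.
- apply/measurable_EFinP; apply: measurable_funM;
    exact: Lfun2_measurable.
- by apply: filterS UU' => t UU' _; rewrite /coords UU'.
Qed.

Lemma cross_moment_eq0 n (U : T -> 'cV[R]_n) : sq_integrable U ->
  cross_moment U U = 0 -> {ae P, forall t, U t = 0}.
Proof.
move=> U2 UU0.
have Ui0 i : {ae P, forall t, coords U i t = 0}.
  have /matrixP/(_ i i) := UU0; rewrite !mxE => E0.
  have iUU := Lfun2_integrableM (U2 i) (U2 i).
  have : (\int[P]_t `|(coords U i t * coords U i t)%:E| = 0)%E.
    under eq_integral do rewrite gee0_abs ?lee_fin -?expr2 ?sqr_ge0//.
    rewrite -[LHS]fineK; last by apply: integrable_fin_num iUU.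
    by congr EFin; rewrite -[RHS]E0.
  move=> /(ae_eq_integral_abs P measurableT (measurable_int _ iUU)).
  apply: filterS => t /(_ I)[] /eqP.
  by rewrite mulf_eq0 orbb => /eqP.
have : {ae P, forall t i, coords U i t = 0} by apply: filter_forall.
by apply: filterS => t Ut; apply/colP => i; rewrite mxE; exact: Ut.
Qed.

Lemma varmxE n (U : T -> 'cV[R]_n) : sq_integrable U ->
  (forall i, 'E_P[coords U i] = 0)%E -> varmx P U = cross_moment U U.
Proof.
move=> U2 EU0; apply/matrixP => i j; rewrite !mxE covarianceE.
- by rewrite !EU0 mule0 sube0 unlock.
- by apply/Lfun1_integrable; exact: Lfun2_integrable.
- by apply/Lfun1_integrable; exact: Lfun2_integrable.
- exact: Lfun2_mul_Lfun1.
Qed.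

End cross_moment.

(** * Conditional expectations of random vectors *)

Section conditional_expectation_of_vectors.
Context {d : measure_display} {T : measurableType d} {R : realType}.
Variables (P : probability T R) (G : set (set T)).
Hypotheses (sG : sigma_algebra setT G) (GM : G `<=` measurable).
Context {n : nat}.
Implicit Types U V : T -> 'cV[R]_n.

Lemma coords_cond_expV U i :
  coords (cond_expV P G U) i = cond_exp P G (coords U i).
Proof. by apply/funext => t; rewrite /coords mxE. Qed.

Lemma is_cond_expV U i : sq_integrable P U ->
  is_cond_exp P G (coords U i) (coords (cond_expV P G U) i).
Proof.
move=> U2; rewrite coords_cond_expV; apply: cond_expP => //.
exact: Lfun2_integrable (U2 i).
Qed.

Lemma cond_expV_sq_integrable U : sq_integrable P U ->
  sq_integrable P (cond_expV P G U).
Proof.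
by move=> U2 i; exact: (cond_exp_Lfun2 sG GM (U2 i) (is_cond_expV i U2)).
Qed.

Lemma expectation_cond_expV U i : sq_integrable P U ->
  ('E_P[coords (cond_expV P G U) i] = 'E_P[coords U i])%E.
Proof.
move=> U2; rewrite unlock; have [_ _ ->//] := is_cond_expV i U2.
by rewrite -setC0; case: sG => G0 GC _; have := GC _ G0; rewrite setTD.
Qed.

(** U - E(U | G) is orthogonal to every square integrable vector that is
measurable with respect to G. *)
Lemma cross_moment_cond_expV m U (V : T -> 'cV[R]_m) :
  sq_integrable P U -> sq_integrable P V ->
  (forall j, measurable_wrt G (coords V j)) ->
  cross_moment P (cond_expV P G U) V = cross_moment P U V.
Proof.
move=> U2 V2 mV; have W2 := cond_expV_sq_integrable U2.
apply/matrixP => i j; rewrite !mxE; congr fine.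
under eq_integral do rewrite mulrC.
under [RHS]eq_integral do rewrite mulrC.
apply: (cond_exp_pull_out sG GM) => //.
- exact: is_cond_expV.
- exact: Lfun2_integrable.
- exact: Lfun2_integrableM.
- exact: Lfun2_integrableM.
Qed.

Lemma cond_expV_unique U V W :
  (forall i, is_cond_exp P G (coords V i) (coords W i)) ->
  sq_integrable P U ->
  (forall i A, G A -> \int[P]_(t in A) (coords U i t)%:E =
                      \int[P]_(t in A) (coords V i t)%:E)%E ->
  {ae P, forall t, cond_expV P G U t = W t}.
Proof.
move=> ceW U2 UV.
have E i : {ae P, forall t, coords (cond_expV P G U) i t = coords W i t}.
  exact: (cond_exp_unique sG GM (is_cond_expV i U2) (ceW i) (UV i)).
have : {ae P, forall t i, coords (cond_expV P G U) i t = coords W i t}.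
  exact: filter_forall.
by apply: filterS => t Et; apply/colP => i; exact: Et.
Qed.

Lemma cond_expV_mulmx_ae (A : 'M[R]_n) U V : sq_integrable P U ->
  sq_integrable P V -> {ae P, forall t, V t = A *m U t} ->
  {ae P, forall t, cond_expV P G V t = A *m cond_expV P G U t}.
Proof.
move=> U2 V2 VAU; apply: (cond_expV_unique (V := fun t => A *m U t)) => //.
  move=> i; rewrite !coords_mulmx; apply: cond_exp_sum => // j.
    exact: Lfun2_integrable.
  exact: is_cond_expV.
move=> i B GB; have mB := GM GB.
have A2 := sq_integrable_mulmx A U2.
apply: ae_eq_integral => //.
- by apply/measurable_EFinP/measurable_funTS; exact: Lfun2_measurable (V2 i).
- by apply/measurable_EFinP/measurable_funTS; exact: Lfun2_measurable (A2 i).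
- by apply: filterS VAU => t VAU _; rewrite /coords VAU.
Qed.

End conditional_expectation_of_vectors.

(** * Conditional independence *)

Section conditional_independence.
Context {d : measure_display} {T : measurableType d} {R : realType}.
Variables (P : probability T R) (G F H : set (set T)).
Hypotheses (sG : sigma_algebra setT G) (sF : sigma_algebra setT F).
Hypotheses (GF : G `<=` F) (FM : F `<=` measurable) (HM : H `<=` measurable).
Hypothesis GHF : cond_indep P G H F.

Let GM : G `<=` measurable := subset_trans GF FM.

Let integral_indicM A (f : T -> R) :
  (\int[P]_(t in A) (f t)%:E = \int[P]_t (\1_A t * f t)%:E)%E.
Proof.
rewrite integral_mkcond; apply: eq_integral => t _.
by rewrite patchE indicE; case: ifPn => _; rewrite ?mul1r ?mul0r.
Qed.

Let cond_probP A : measurable A -> is_cond_exp P G \1_A (cond_prob P G A).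
Proof.
move=> mA; apply: cond_expP => //.
by apply: Lfun2_integrable; exact: Lfun2_indic.
Qed.

Let cond_prob2 A : measurable A -> cond_prob P G A \in Lfun P 2%:E.
Proof.
move=> mA; apply: (cond_exp_Lfun2 sG GM (Z := \1_A)); first exact: Lfun2_indic.
exact: cond_probP.
Qed.

(** Given G contained in F, conditioning an event A of H on all of F brings
nothing beyond G. For B in F, P(A and B) is E(P(A | G) P(B | G)) by conditional
independence, and this is E(P(A | G) 1_B) by pulling out P(A | G). *)
Lemma cond_indep_cond_exp A : H A -> is_cond_exp P F \1_A (cond_prob P G A).
Proof.
move=> HA; have mA := HM HA; have [mPA iPA PAE] := cond_probP mA.
split => //; first by move=> B mB; apply: GF; exact: mPA.
move=> B FB; have mB := FM FB; have mAB := measurableI _ _ mA mB.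
have [_ _ PABE] := cond_probP mAB.
have GT : G setT by case: sG => G0 GC _; have := GC _ G0; rewrite setTD setC0.
have PA2 := cond_prob2 mA; have PB2 := cond_prob2 mB.
rewrite [LHS]integral_indicM [RHS]integral_indicM.
transitivity (\int[P]_t (cond_prob P G A t * \1_B t)%:E)%E.
  by apply: eq_integral => t _; rewrite mulrC.
rewrite -(cond_exp_pull_out sG GM (Z := \1_B) (W := cond_prob P G B)) //.
- transitivity (\int[P]_t (cond_prob P G (A `&` B) t)%:E)%E.
    apply: ae_eq_integral => //.
    + apply/measurable_EFinP; apply: measurable_funM.
        exact: Lfun2_measurable PA2.
      exact: Lfun2_measurable PB2.
    + by apply/measurable_EFinP; exact: Lfun2_measurable (cond_prob2 mAB).
    + by apply: filterS (GHF HA FB) => t -> _.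
  rewrite PABE//; apply: eq_integral => t _.
  by rewrite !indicE in_setI andbC -mulnb natrM.
- exact: cond_probP.
- by apply: Lfun2_integrable; exact: Lfun2_indic.
- by apply: Lfun2_integrableM => //; exact: Lfun2_indic.
- exact: Lfun2_integrableM.
Qed.

(** Pulling out, in turn, Z from P(A | F) = P(A | G), then P(A | G) from
E(Z | G), then E(Z | G) from P(A | G):
E(1_A Z) = E(P(A | G) Z) = E(P(A | G) E(Z | G)) = E(1_A E(Z | G)). *)
Lemma cond_indep_tower (Z : T -> R) : measurable_wrt F Z -> Z \in Lfun P 2%:E ->
  forall A, H A -> (\int[P]_(t in A) (Z t)%:E =
                    \int[P]_(t in A) (cond_exp P G Z t)%:E)%E.
Proof.
move=> mZ Z2 A HA; have mA := HM HA.
have ceZ : is_cond_exp P G Z (cond_exp P G Z).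
  by apply: cond_expP => //; exact: Lfun2_integrable.
have W2 := cond_exp_Lfun2 sG GM Z2 ceZ.
have A2 : (\1_A : T -> R) \in Lfun P 2%:E by exact: Lfun2_indic.
have PA2 := cond_prob2 mA.
have [mPA _ _] := cond_probP mA; have [mW _ _] := ceZ.
rewrite [LHS]integral_indicM [RHS]integral_indicM.
transitivity (\int[P]_t (Z t * cond_prob P G A t)%:E)%E.
  rewrite (cond_exp_pull_out sF FM (Z := \1_A))//.
  - by apply: eq_integral => t _; rewrite mulrC.
  - exact: cond_indep_cond_exp.
  - exact: Lfun2_integrable.
  - exact: Lfun2_integrableM.
  - exact: Lfun2_integrableM.
transitivity (\int[P]_t (cond_exp P G Z t * cond_prob P G A t)%:E)%E.
  under eq_integral do rewrite mulrC.
  under [RHS]eq_integral do rewrite mulrC.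
  symmetry; apply: (cond_exp_pull_out sG GM) => //.
  - exact: Lfun2_integrable.
  - exact: Lfun2_integrableM.
  - exact: Lfun2_integrableM.
under [RHS]eq_integral do rewrite mulrC.
apply: (cond_exp_pull_out sG GM) => //.
- exact: cond_probP.
- exact: Lfun2_integrable.
- exact: Lfun2_integrableM.
- exact: Lfun2_integrableM.
Qed.

End conditional_independence.

(** * Solution spaces and the inverse regression space *)

Section inverse_regression.
Context {d : measure_display} {T : measurableType d} {R : realType}.
Context (P : probability T R) {p : nat}.
Context (X : T -> 'cV[R]_p) (Y : T -> R).
Hypothesis X2 : sq_integrable P X.
Hypothesis mY : measurable_fun setT Y.

Local Notation Sigma := (cross_moment P X X).
Local Notation m := (cond_expV P (sigmaR Y) X).

Let sY := sigma_algebra_sigmaR Y.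
Let YM := sigmaR_measurable mY.

Lemma reduction_sq_integrable n (beta : 'M[R]_(p, n)) :
  sq_integrable P (reduction X beta).
Proof. exact: sq_integrable_mulmx. Qed.

Lemma sigmaV_reduction_measurable n (beta : 'M[R]_(p, n)) :
  sigmaV (reduction X beta) `<=` measurable.
Proof. exact/sigmaV_measurable/reduction_sq_integrable. Qed.

Lemma dr_space_solution V : dr_space P X Y V -> solution_space P X Y V.
Proof.
move=> [n [beta [-> ci]]]; exists n, beta; split => //.
have sG := sigma_algebra_sigmaV (reduction X beta).
have GM := @sigmaV_reduction_measurable _ beta.
have sX := sigma_algebra_sigmaV X.
have XM := sigmaV_measurable X2.
pose E := cond_expV P (sigmaV (reduction X beta)) X.
have E2 : sq_integrable P E := cond_expV_sq_integrable sG GM X2.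
apply: (cond_expV_unique sY YM (V := E) _ X2) => [i|i A YA].
  exact: (is_cond_expV sY YM).
rewrite /E coords_cond_expV.
apply: (cond_indep_tower sG sX _ XM YM ci _ (X2 i) YA).
- exact: sigmaV_mulmx.
- exact: sigmaV_coords.
Qed.

(** Taking the cross moment of A X = E(X | eta^T X) with eta^T X gives
A Sigma eta = Sigma eta. Multiplied by B^T on the right, this reads
A Sigma A^T = Sigma A^T with A = B eta^T; the left-hand side is symmetric, and
therefore Sigma A^T = A Sigma. *)
Lemma linear_cond_mean_projection n (eta B : 'M[R]_(p, n)) :
  {ae P, forall t,
     cond_expV P (sigmaV (reduction X eta)) X t = (B *m eta^T) *m X t} ->
  (B *m eta^T) *m Sigma *m eta = Sigma *m eta /\
  (B *m eta^T) *m Sigma = Sigma *m eta *m B^T.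
Proof.
set A := B *m eta^T => lin.
have sG := sigma_algebra_sigmaV (reduction X eta).
have GM := @sigmaV_reduction_measurable _ eta.
have r2 := reduction_sq_integrable eta.
have E2 := cond_expV_sq_integrable sG GM X2.
have A2 := sq_integrable_mulmx A X2.
have ASeta : A *m Sigma *m eta = Sigma *m eta.
  have := cross_moment_cond_expV sG GM X2 r2
    (@sigmaV_coords _ _ _ _ (reduction X eta)).
  rewrite (cross_moment_ae (U' := fun t => A *m X t))//.
  rewrite cross_moment_mull// cross_moment_mulr// trmxK mulmxA.
  by move->.
split => //.
have AT : A^T = eta *m B^T by rewrite trmx_mul trmxK.
have ST : Sigma^T = Sigma by exact: cross_momentT.
have SAT : A *m Sigma *m A^T = Sigma *m A^T by rewrite AT !mulmxA ASeta.
rewrite -[RHS]mulmxA -AT -[LHS]trmxK (trmx_mul A) ST -SAT.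
by rewrite (trmx_mul (A *m _)) (trmx_mul A) trmxK ST mulmxA.
Qed.

(** For linear E(X | eta^T X) = A X, the inverse regression equation reads
m = E(A X | Y) = A m. The matrix beta witnessing a solution space need not be
the basis eta for which linearity holds; both generate the same
sigma-algebra. *)
Lemma solution_cond_mean_fixed n k (beta : 'M[R]_(p, n))
    (eta B : 'M[R]_(p, k)) :
  colspan beta = colspan eta -> inverse_regression_eq P X Y beta ->
  {ae P, forall t,
     cond_expV P (sigmaV (reduction X eta)) X t = (B *m eta^T) *m X t} ->
  {ae P, forall t, m t = (B *m eta^T) *m m t}.
Proof.
move=> be ire lin.
have sG := sigma_algebra_sigmaV (reduction X eta).
have GM := @sigmaV_reduction_measurable _ eta.
have E2 := cond_expV_sq_integrable sG GM X2.
have GE : sigmaV (reduction X beta) = sigmaV (reduction X eta).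
  by apply/seteqP; split; apply: sigmaV_reduction_sub; rewrite be.
have tower := cond_expV_mulmx_ae sY YM X2 E2 lin.
rewrite /inverse_regression_eq GE in ire.
by apply: filterS2 ire tower => t -> <-.
Qed.

Lemma cond_mean_fixed_solution n (eta B : 'M[R]_(p, n)) :
  {ae P, forall t,
     cond_expV P (sigmaV (reduction X eta)) X t = (B *m eta^T) *m X t} ->
  {ae P, forall t, m t = (B *m eta^T) *m m t} ->
  inverse_regression_eq P X Y eta.
Proof.
move=> lin fixm.
have sG := sigma_algebra_sigmaV (reduction X eta).
have GM := @sigmaV_reduction_measurable _ eta.
have E2 := cond_expV_sq_integrable sG GM X2.
have tower := cond_expV_mulmx_ae sY YM X2 E2 lin.
by apply: filterS2 fixm tower => t mE ->; exact: mE.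
Qed.

Let m2 : sq_integrable P m := cond_expV_sq_integrable sY YM X2.

Lemma colspan_basis n V (eta : 'M[R]_(p, n)) :
  basis_of V (columns eta) -> V = colspan eta.
Proof. by move=> /span_basis <-. Qed.

Hypothesis SigmaU : Sigma \in unitmx.

Local Notation M := (cross_moment P m m).
Local Notation IR := (colspan (invmx Sigma *m M *m invmx Sigma)).

(** From m = A m comes M = A M, and the identity A Sigma = Sigma eta B^T lets
Sigma^-1 A = eta B^T Sigma^-1 bring eta to the left of
Sigma^-1 M Sigma^-1. *)
Lemma inverse_regression_sub_solution V :
  solution_space P X Y V -> linear_cond_mean P X V -> (IR <= V)%VS.
Proof.
move=> [n [beta [Vb ire]]] [k [eta [/colspan_basis Ve [B lin]]]].
have [_ ASE] := linear_cond_mean_projection lin.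
have fixm := solution_cond_mean_fixed (etrans (esym Vb) Ve) ire lin.
have ME : M = (B *m eta^T) *m M.
  rewrite -cross_moment_mull//; apply: cross_moment_ae => //.
  exact: sq_integrable_mulmx.
have SA : invmx Sigma *m (B *m eta^T) = eta *m (B^T *m invmx Sigma).
  by rewrite -[LHS](mulmxK SigmaU) -(mulmxA _ _ Sigma) ASE
    !mulmxA mulVmx// mul1mx.
rewrite Ve ME [invmx Sigma *m _]mulmxA SA -!mulmxA.
exact: colspan_mulmx.
Qed.

(** If Sigma^-1 M Sigma^-1 = eta C then M = Sigma eta C Sigma is fixed by A, so
the second moment (I - A) M (I - A)^T of m - A m is zero. *)
Lemma inverse_regression_solution :
  linear_cond_mean P X IR -> solution_space P X Y IR.
Proof.
move=> [n [eta [/colspan_basis Ve [B lin]]]].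
exists n, eta; split => //; apply: (cond_mean_fixed_solution lin).
have [ASe _] := linear_cond_mean_projection lin.
set A := B *m eta^T in ASe *.
have [C CE] : exists C, invmx Sigma *m M *m invmx Sigma = eta *m C.
  by apply: colspan_factor; rewrite Ve.
have ME : M = Sigma *m eta *m C *m Sigma.
  by rewrite -[Sigma *m eta *m C]mulmxA -CE !mulmxA mulmxV// mul1mx mulmxKV.
have AM : A *m M = M by rewrite ME !mulmxA ASe.
pose D := 1%:M - A.
have DM0 : D *m M = 0 by rewrite mulmxBl mul1mx AM subrr.
have : {ae P, forall t, D *m m t = 0}.
  apply: cross_moment_eq0; first exact: sq_integrable_mulmx.
  rewrite cross_moment_mull// ?cross_moment_mulr//; last first.
    exact: sq_integrable_mulmx.
  by rewrite mulmxA DM0 mul0mx.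
apply: filterS => t /eqP; rewrite mulmxBl mul1mx subr_eq0 => /eqP //.
Qed.

End inverse_regression.

Unset Implicit Arguments.
Set Strict Implicit.

Theorem theorem2p1 (R : realType) (d : measure_display) (T : measurableType d)
    (P : probability T R) (p : nat) (X : T -> 'cV[R]_p) (Y : {RV P >-> R})
    (X2 : forall i, coords X i \in Lfun P 2%:E)
    (Y2 : (Y : T -> R) \in Lfun P 2%:E)
    (EX0 : forall i, ('E_P[coords X i] = 0)%E)
    (Sigma_posdef : posdefmx (varmx P X))
    (central_space_exists : dr_space P X Y (central_space P X Y))
    (solution_spaceI : forall U V : {vspace 'cV[R]_p},
       solution_space P X Y U -> solution_space P X Y V ->
       solution_space P X Y (U :&: V)%VS) :
  (central_solution_space P X Y <= central_space P X Y)%VS /\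
  (linear_cond_mean P X (central_solution_space P X Y) ->
   linear_cond_mean P X (inverse_regression_space P X Y) ->
   inverse_regression_space P X Y = central_solution_space P X Y).
Proof.
have mY : measurable_fun setT (Y : T -> R) by exact: Lfun2_measurable Y2.
have sY := sigma_algebra_sigmaR (Y : T -> R).
have YM := sigmaR_measurable mY.
have central_sol := dr_space_solution X2 mY central_space_exists.
have CSS_sol : solution_space P X Y (central_solution_space P X Y).
  exact: vbigcap_mem central_sol solution_spaceI.
split; first exact: vbigcap_sub.
have m2 := cond_expV_sq_integrable sY YM X2.
have SigmaU := posdefmx_unit Sigma_posdef.
rewrite /inverse_regression_space.
rewrite [varmx P (cond_expV _ _ _)]varmxE//; last first.
  by move=> i; rewrite expectation_cond_expV.
rewrite varmxE// in SigmaU *.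
move=> linC linI; apply: subv_anti; apply/andP; split.
  exact: inverse_regression_sub_solution.
by apply: vbigcap_sub; exact: inverse_regression_solution.
Qed.
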